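(* Let $n>1$ be an integer, let $p_0>0$ and $p_1,\ldots,p_n>0$ be real numbers with $\sum_{i=1}^n p_i = 1-p_0$, and let $\gamma$ be a real root of the equation $\sum_{i=1}^n p_i^{\gamma}=1$. For each integer $r\ge 1$ let $p(r)$ denote the probability of the word of rank $r$ in the random text model with letter probabilities $p_1,\ldots,p_n$ and space probability $p_0$. Then there exist real constants $c_1,c_2$ such that for all integers $r\ge 1$ $$c_1 < \ln p(r) + \frac{\ln r}{\gamma} < c_2 .$$
   Context: Random text (''monkey'') model: symbols are typed independently. At each step the $i$-th letter of an alphabet of $n$ letters is typed with probability $p_i$ ($i=1,\ldots,n$), and the space is typed with probability $p_0$. A word is a nonempty finite sequence of letters (the sequence of letters between two spaces). A word $w$ that contains exactly $k_i$ occurrences of the $i$-th letter for $i=1,\ldots,n$ has probability $\Pr(w)=p_1^{k_1}\cdots p_n^{k_n}\,p_0$. Ranks: all words are listed in nonincreasing order of probability, with words of equal probability listed in succession in an arbitrary order. The rank of a word is its position ($1,2,3,\ldots$) in this list. Thus $p(r)$ is the probability $\Pr(w)$ of the $r$-th word $w$ in the list; it does not depend on how ties are broken. *)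

(* Defs.v *)
From HB Require Import structures.
From mathcomp Require Import all_boot all_order all_algebra.
From mathcomp Require Import all_classical all_reals all_analysis.

Set Implicit Arguments.
Unset Strict Implicit.
Unset Printing Implicit Defensive.

Import Order.TTheory GRing.Theory Num.Theory.
Local Open Scope ring_scope.

Definition word (n : nat) := {w : seq 'I_n | w != [::]}.

Definition word_prob (R : realType) (n : nat) (p0 : R) (p : 'I_n -> R)
    (w : word n) : R :=
  (\prod_(i < n) p i ^+ count_mem i (\val w)) * p0.

(* Words of equal probability are automatically consecutive in such a list;
   their relative order is unconstrained. *)
Definition ranked_list (R : realType) (n : nat) (p0 : R) (p : 'I_n -> R)
    (L : nat -> word n) : Prop :=
  bijective L /\
  forall i j : nat, (i <= j)%N -> word_prob p0 p (L j) <= word_prob p0 p (L i).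

(* Ranks start at 1 whereas [L] is indexed from 0; the value at r = 0 is
   meaningless. *)
Definition rank_prob (R : realType) (n : nat) (p0 : R) (p : 'I_n -> R)
    (L : nat -> word n) (r : nat) : R :=
  word_prob p0 p (L r.-1).

(* Main.v *)
(* Put [q i = p i `^ gamma], so that the [q i] sum to 1, and let [N t] be the
   number of words, the empty one included, whose q-weight is at least [t].
   Splitting off the first letter, [F t = (n - 1) N t + 1] satisfies
   [F t = \sum_i F (t / q i)] for [t <= 1], and [F t = 1] for [t > 1].  The
   function [1 / t] solves the same recursion, whence
   [1 / t <= F t <= 1 / (t * min q)].  If [x] is the q-weight of the word of
   rank [r], then [r <= N x] and [N (2 x) <= r], so [x * r] lies between two
   positive constants; take logarithms. *)
Require Import Defs.
From HB Require Import structures.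
From mathcomp Require Import all_boot all_order all_algebra.
From mathcomp Require Import all_classical all_reals all_analysis.
From mathcomp Require Import lra zify.

Set Implicit Arguments.
Unset Strict Implicit.
Unset Printing Implicit Defensive.

Import Order.TTheory GRing.Theory Num.Theory.
Local Open Scope ring_scope.

(** The factor [p0] is left out, so that the empty word has weight 1 and prepending a letter
    multiplies the weight by that letter's value. *)
Definition weight (R : realType) (n : nat) (q : 'I_n -> R) (w : seq 'I_n) : R :=
  \prod_(i <- w) q i.

Lemma weight_cons (R : realType) (n : nat) (q : 'I_n -> R) i w :
  weight q (i :: w) = q i * weight q w.
Proof. by rewrite /weight big_cons. Qed.

Lemma weight_gt0 (R : realType) (n : nat) (q : 'I_n -> R) w :
  (forall i, 0 < q i) -> 0 < weight q w.
Proof. by move=> q_gt0; apply: prodr_gt0 => i _. Qed.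

Lemma weight_le1 (R : realType) (n : nat) (q : 'I_n -> R) w :
  (forall i, 0 < q i) -> (forall i, q i <= 1) -> weight q w <= 1.
Proof.
by move=> q_gt0 q_le1; apply: prodr_ile1 => i _; rewrite (ltW (q_gt0 i)) q_le1.
Qed.

Lemma weight_count (R : realType) (n : nat) (q : 'I_n -> R) w :
  \prod_(i < n) q i ^+ count_mem i w = weight q w.
Proof.
elim: w => [|j w IHw]; first by rewrite /weight big_nil big1.
rewrite weight_cons -IHw.
under eq_bigr do rewrite /= exprD.
rewrite big_split /=; congr (_ * _).
rewrite (bigD1 j) //= eqxx expr1 big1 ?mulr1 // => i ne_ij.
by rewrite eq_sym (negPf ne_ij).
Qed.

Lemma weight_powR (R : realType) (n : nat) (p : 'I_n -> R) (a : R) w :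
  (forall i, 0 < p i) -> weight (fun i => p i `^ a) w = weight p w `^ a.
Proof.
move=> p_gt0; elim: w => [|j w IHw]; first by rewrite /weight !big_nil powR1.
by rewrite !weight_cons IHw powRM // ltW // weight_gt0.
Qed.

(* The recursion on [k] only serves termination: see [mem_heavy_words]. *)
Fixpoint heavy_words (R : realType) (n : nat) (q : 'I_n -> R) (k : nat) (t : R)
    : seq (seq 'I_n) :=
  if k is k'.+1 then
    if t <= 1 then
      [::] :: [seq i :: w | i <- enum 'I_n, w <- heavy_words q k' (t / q i)]
    else [::]
  else [::].

Section HeavyWords.
Variables (R : realType) (n : nat) (q : 'I_n -> R).
Hypotheses (q_gt0 : forall i, 0 < q i) (q_le1 : forall i, q i <= 1).

(** No weight exceeds 1, so nothing is heavy when [t > 1]; otherwise [i :: v] reaches [t] exactly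
    when [v] reaches [t / q i]. *)
Lemma mem_heavy_words k t w :
  (w \in heavy_words q k t) = (size w < k)%N && (t <= weight q w).
Proof.
elim: k t w => [|k IHk] t w //=.
case: (leP t 1) => [t_le1|t_gt1]; last first.
  by rewrite in_nil [t <= _]leNgt (le_lt_trans (weight_le1 _ q_gt0 q_le1)) ?andbF.
case: w => [|i w]; first by rewrite mem_head /weight big_nil.
rewrite inE /= weight_cons ltnS -ler_pdivrMl ?q_gt0 // [_^-1 * _]mulrC -IHk.
apply/allpairsPdep/idP => [[j [v [_ v_heavy [-> ->]]]]//|w_heavy].
by exists i, w; rewrite mem_enum.
Qed.

Lemma uniq_heavy_words k t : uniq (heavy_words q k t).
Proof.
elim: k t => [|k IHk] t //=; case: ifP => //= _.
apply/andP; split; first by apply/allpairsPdep => -[i [w []]].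
apply: allpairs_uniq_dep => [|i _|]; rewrite ?enum_uniq //.
by move=> [i w] [j v] _ _ /= [-> ->].
Qed.

Hypotheses (n_gt1 : (1 < n)%N) (q_sum : \sum_(i < n) q i = 1).

(** The empty word contributes [n - 1]; together with the leading 1 this gives one unit for each of
    the [n] summands. *)
Lemma size_heavy_words k t : t <= 1 ->
  1 + (n.-1 * size (heavy_words q k.+1 t))%:R =
  \sum_(i < n) (1 + (n.-1 * size (heavy_words q k (t / q i)))%:R) :> R.
Proof.
move=> t_le1; rewrite /= t_le1 /= size_allpairs_dep sumnE big_map big_enum /=.
rewrite mulnS natrD addrA -mulrS prednK ?(ltnW n_gt1) // big_split /=.
by rewrite sumr_const card_ord big_distrr /= natr_sum.
Qed.

(** Induction on [k]. The range [t <= m^-1] is where the right side is at least 1, as the base case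
    needs, and [t <= 1] keeps every [t / q i] inside it. Cutting off long words only lowers the
    count, so [k] is arbitrary. *)
Lemma size_heavy_words_le (m : R) k (t : R) : 0 < m -> (forall i, m <= q i) ->
  0 < t -> t <= m^-1 ->
  1 + (n.-1 * size (heavy_words q k t))%:R <= (t * m)^-1.
Proof.
move=> m_gt0 m_le; elim: k t => [|k IHk] t t_gt0 t_le.
  by rewrite muln0 addr0 invf_ge1 ?mulr_gt0 // -ler_pdivlMr // div1r.
case: (leP t 1) => [t_le1|t_gt1]; last first.
  rewrite /= [t <= 1]leNgt t_gt1 /= muln0 addr0 invf_ge1 ?mulr_gt0 //.
  by rewrite -ler_pdivlMr // div1r.
have -> : (t * m)^-1 = \sum_(i < n) q i * (t * m)^-1.
  by rewrite -mulr_suml q_sum mul1r.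
rewrite size_heavy_words //; apply: ler_sum => i _.
have -> : q i * (t * m)^-1 = (t / q i * m)^-1.
  by rewrite !invfM invrK mulrA [_ * q i]mulrC.
apply: IHk; first by rewrite divr_gt0.
apply: (@le_trans _ _ (q i)^-1); last by rewrite lef_pV2 ?posrE.
by rewrite ler_pdivrMr // mulVf ?gt_eqF.
Qed.

(** Here the cut-off matters: [M ^+ k < t] forces every word of weight at least [t] to be shorter
    than [k]. It passes to [t / q i] with [k] lowered by one, and at [k = 0] it reads [1 < t]. *)
Lemma size_heavy_words_ge (M : R) k (t : R) :
  0 < M -> (forall i, q i <= M) -> M ^+ k < t ->
  t^-1 <= 1 + (n.-1 * size (heavy_words q k t))%:R.
Proof.
move=> M_gt0 le_M.
have big_t u s : 1 < u -> u^-1 <= 1 + (n.-1 * s)%:R :> R.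
  move=> u_gt1; apply: (@le_trans _ _ 1); last by rewrite lerDl.
  by rewrite invf_le1 ?ltW // (lt_trans ltr01).
elim: k t => [|k IHk] t Mk_lt; first exact: big_t.
have [t_le1|t_gt1] := leP t 1; last exact: big_t.
have -> : t^-1 = \sum_(i < n) q i * t^-1 by rewrite -mulr_suml q_sum mul1r.
rewrite size_heavy_words //; apply: ler_sum => i _.
have -> : q i / t = (t / q i)^-1 by rewrite invfM invrK mulrC.
apply: IHk; rewrite ltr_pdivlMr //; apply: le_lt_trans Mk_lt.
by rewrite exprSr ler_wpM2l // exprn_ge0 // ltW.
Qed.

End HeavyWords.

Lemma exp_eventually_lt (R : realType) (M t : R) :
  0 < M -> M < 1 -> 0 < t -> exists k : nat, M ^+ k < t.
Proof.
move=> M_gt0 M_lt1 t_gt0.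
have M_cvg : (M ^+ k @[k --> \oo] --> 0)%classic.
  by apply: cvg_expr; rewrite gtr0_norm.
have [k _ lt_t] := cvgr_lt 0 M_cvg t t_gt0.
by exists k; apply: lt_t => /=.
Qed.

Lemma finite_lower_bound (R : realType) (n : nat) (q : 'I_n -> R) :
  (forall i, 0 < q i) -> exists2 m : R, 0 < m & forall i, m <= q i.
Proof.
move=> q_gt0; exists (\big[Num.min/1]_(i < n) q i).
  by apply: lt_bigmin => // i _.
by move=> i; apply: bigmin_le_cond.
Qed.

Lemma ranked_weight_bounds (R : realType) (n : nat) (q : 'I_n -> R)
    (L : nat -> word n) :
  (1 < n)%N -> (forall i, 0 < q i) -> \sum_(i < n) q i = 1 ->
  bijective L ->
  (forall i j, (i <= j)%N -> weight q (\val (L j)) <= weight q (\val (L i))) ->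
  exists a b : R, 0 < a /\
    forall s, a <= weight q (\val (L s)) * s.+1%:R <= b.
Proof.
move=> n_gt1 q_gt0 q_sum L_bij L_mono.
have [m m_gt0 m_le] := finite_lower_bound q_gt0.
(* A second letter takes at least [m] of the total 1. Hence weights decay geometrically with
   length. *)
have q_leB i : q i <= 1 - m.
  rewrite lerBrDr -q_sum (bigD1 i) //= lerD2l.
  have [j ne_ji] : exists j, j != i.
    have /card_gt0P[j] : (0 < #|predC1 i|)%N.
      by rewrite cardC1 card_ord -subn1 subn_gt0.
    by exists j.
  by rewrite (bigD1 j) //= ler_wpDr ?sumr_ge0 // => h _; exact: ltW.
have i0 : 'I_n := Ordinal n_gt1.
have M_gt0 : 0 < 1 - m by apply: lt_le_trans (q_gt0 i0) (q_leB i0).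
have M_lt1 : 1 - m < 1 by rewrite ltrBlDr ltrDl.
have q_le1 i : q i <= 1 by apply: le_trans (q_leB i) (ltW M_lt1).
have w_inj : injective (fun j => \val (L j)).
  by move=> i j /val_inj; apply: (bij_inj L_bij).
(* The lower constant comes from [1 / (2 x) <= 1 + (n - 1) N (2 x) <= 2 n (s + 1)], the upper one
   from [s + 1 <= N x]. *)
exists (4 * n%:R)^-1, m^-1; split.
  by rewrite invr_gt0 mulr_gt0 // ltr0n ltnW.
move=> s; set x := weight q _.
have x_gt0 : 0 < x := weight_gt0 _ q_gt0.
have x_le1 : x <= 1 := weight_le1 _ q_gt0 q_le1.
apply/andP; split; last first.
  (* Upper bound: the first [s + 1] words all weigh at least [x], and [k] exceeds all their
     lengths. *)
  pose ranked := [seq \val (L j) | j <- iota 0 s.+1].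
  pose k := (\max_(w <- ranked) size w).+1.
  have le_size : (s.+1 <= size (heavy_words q k x))%N.
    rewrite -[s.+1](size_iota 0) -(size_map (fun j => \val (L j))).
    apply: uniq_leq_size; first by rewrite map_inj_uniq ?iota_uniq.
    move=> w w_in; rewrite mem_heavy_words // ltnS leq_bigmax_seq //=.
    by have /mapP[j] := w_in; rewrite mem_iota ltnS => /= j_le ->; exact: L_mono.
  have x_le : x <= m^-1.
    apply: le_trans x_le1 _; rewrite invf_ge1 //.
    by apply: le_trans (m_le i0) (q_le1 i0).
  have := size_heavy_words_le q_gt0 n_gt1 q_sum k m_gt0 m_le x_gt0 x_le.
  rewrite invfM -(ler_pM2l x_gt0) mulVKf ?gt_eqF //; apply: le_trans.
  rewrite ler_pM2l // -[1]/(1%:R) -natrD ler_nat (leq_trans le_size) //.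
  by rewrite (leq_trans _ (leqnSn _)) // leq_pmull // -subn1 subn_gt0.
have [k k_lt] := exp_eventually_lt M_gt0 M_lt1 (mulr_gt0 (ltr0Sn R 1) x_gt0).
(* Doubling the threshold excludes ties with [x]: a nonempty word of weight at least [2 * x] has
   index below [s]. The empty word, absent from the list [L], adds one. *)
have size_le : (size (heavy_words q k (2 * x)) <= s.+1)%N.
  have -> : s.+1 = size ([::] :: [seq \val (L j) | j <- iota 0 s]).
    by rewrite /= size_map size_iota.
  apply: uniq_leq_size; first exact: uniq_heavy_words.
  move=> w; rewrite mem_heavy_words // => /andP[_ w_heavy].
  rewrite inE; case: eqVneq => //= w_neq0.
  have [L' _ LK] := L_bij; pose j := L' (exist _ w w_neq0).
  have wE : w = \val (L j) by rewrite LK.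
  rewrite wE; apply: (map_f (fun j => \val (L j))).
  rewrite mem_iota /= add0n ltnNge; apply/negP => /L_mono.
  rewrite -wE; apply/negP; rewrite -ltNge; apply: lt_le_trans w_heavy.
  by rewrite mulr2n mulrDl mul1r ltrDl.
have := size_heavy_words_ge q_gt0 n_gt1 q_sum M_gt0 q_leB k_lt.
have : 1 + (n.-1 * size (heavy_words q k (2 * x)))%:R <= (2 * n * s.+1)%:R :> R.
  rewrite -[1]/(1%:R) -natrD ler_nat.
  apply: (@leq_trans (1 + n * s.+1)); last by nia.
  by rewrite leq_add2l leq_mul // leq_pred.
move=> le_2n /le_trans/(_ le_2n); rewrite !natrM.
have n_gt0 : 0 < n%:R :> R by rewrite ltr0n ltnW.
rewrite -[_^-1]div1r ler_pdivrMr ?mulr_gt0 // => le_x.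
by rewrite -[_^-1]div1r ler_pdivrMr ?mulr_gt0 //; lra.
Qed.

(** For [a <= 0] every term would be at least 1 and the sum at least [n > 1]. *)
Lemma powR_sum1_gt0 (R : realType) (n : nat) (p : 'I_n -> R) (a : R) :
  (1 < n)%N -> (forall i, 0 < p i) -> (forall i, p i < 1) ->
  \sum_(i < n) p i `^ a = 1 -> 0 < a.
Proof.
move=> n_gt1 p_gt0 p_lt1 p_sum; rewrite ltNge; apply/negP => a_le0.
suff : \sum_(i < n) (1 : R) <= \sum_(i < n) p i `^ a.
  by rewrite p_sum sumr_const card_ord lern1 leqNgt n_gt1.
apply: ler_sum => i _.
by rewrite -(powRr0 (p i)) ger_powR // p_gt0 ltW.
Qed.

Theorem theorem1 (R : realType) (n : nat) (p0 : R) (p : 'I_n -> R) (gamma : R)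
    (L : nat -> word n) :
  (1 < n)%N ->
  0 < p0 ->
  (forall i : 'I_n, 0 < p i) ->
  \sum_(i < n) p i = 1 - p0 ->
  \sum_(i < n) p i `^ gamma = 1 ->
  ranked_list p0 p L ->
  exists c1 c2 : R, forall r : nat, (1 <= r)%N ->
    c1 < ln (rank_prob p0 p L r) + ln (r%:R : R) / gamma < c2.
Proof.
move=> n_gt1 p0_gt0 p_gt0 p_sum q_sum [L_bij L_mono].
have p_lt1 i : p i < 1.
  apply: (@le_lt_trans _ _ (1 - p0)); last by rewrite ltrBlDr ltrDl.
  by rewrite -p_sum (bigD1 i) //= lerDl sumr_ge0 // => j _; exact: ltW.
have g_gt0 := powR_sum1_gt0 n_gt1 p_gt0 p_lt1 q_sum.
have probE w : word_prob p0 p w = weight p (\val w) * p0.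
  by rewrite /word_prob weight_count.
have q_gt0 i : 0 < p i `^ gamma by rewrite powR_gt0.
(* As [gamma > 0], the power map is increasing, so ranking by probability also ranks by q-weight. *)
have q_mono i j : (i <= j)%N ->
    weight (fun i => p i `^ gamma) (\val (L j)) <=
    weight (fun i => p i `^ gamma) (\val (L i)).
  move=> /L_mono; rewrite !probE ler_pM2r // !weight_powR // => le_ji.
  by apply: ge0_ler_powR => //; rewrite ?nnegrE ltW ?weight_gt0.
have [a [b [a_gt0 ab]]] := ranked_weight_bounds n_gt1 q_gt0 q_sum L_bij q_mono.
(* The shifts by 1 make the inequalities strict. *)
exists (ln p0 + ln a / gamma - 1), (ln p0 + ln b / gamma + 1) => -[//|s] _.
rewrite /rank_prob probE /=; set x := weight p _.
have x_gt0 : 0 < x by exact: weight_gt0.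
have := ab s; rewrite weight_powR // -/x => /andP[a_le le_b].
have xr_gt0 : 0 < x `^ gamma * s.+1%:R by rewrite mulr_gt0 ?powR_gt0.
have -> : ln (x * p0) + ln s.+1%:R / gamma =
    ln p0 + ln (x `^ gamma * s.+1%:R) / gamma.
  rewrite !lnM ?posrE ?powR_gt0 // ln_powR.
  by rewrite mulrDl mulrAC mulfV ?gt_eqF // mul1r addrA [ln p0 + _]addrC.
have : ln a / gamma <= ln (x `^ gamma * s.+1%:R) / gamma.
  by rewrite ler_pM2r ?invr_gt0 // ler_ln ?posrE.
have : ln (x `^ gamma * s.+1%:R) / gamma <= ln b / gamma.
  by rewrite ler_pM2r ?invr_gt0 // ler_ln ?posrE // (lt_le_trans xr_gt0).
by move=> ? ?; apply/andP; split; lra.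
Qed.
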